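(* Let $(x^k)_{k\in\mathbb{N}}$ be an infinite sequence generated by GInexPM with constant step size $\alpha$ satisfying $0<\alpha<(1-2\bar\gamma)/L$ (as described in the context), and assume that $f$ is pseudoconvex. Then $\Omega^*\neq\varnothing$ if and only if $(x^k)_{k\in\mathbb{N}}$ has at least one cluster point. Moreover, if $\Omega^*\ne\varnothing$ then $(x^k)_{k\in\mathbb{N}}$ converges to a point of $\Omega^*$; otherwise, $\lim_{k\to\infty}\|x^k\|=\infty$ and $\lim_{k\to\infty}f(x^k)=\inf\{f(x):x\in C\}$ (possibly $-\infty$).
   Context: Setting. $C\subset\mathbb{R}^n$ is a nonempty closed convex set, $f:\mathbb{R}^n\to\mathbb{R}$ is continuously differentiable, $\Omega^*$ is the (possibly empty) set of minimizers of $f$ over $C$, $\langle\cdot,\cdot\rangle$ and $\|\cdot\|$ are the Euclidean inner product and norm, and $\mathbb{N}=\{0,1,2,\dots\}$. The gradient is Lipschitz on $C$ with constant $L>0$: $\|\nabla f(x)-\nabla f(y)\|\le L\|x-y\|$ for all $x,y\in C$. $f$ is pseudoconvex if, for all $x,y\in C$, $\langle\nabla f(y),x-y\rangle\ge 0$ implies $f(x)\ge f(y)$. Inexact projection. For each $\gamma=(\gamma_1,\gamma_2,\gamma_3)\in\mathbb{R}^3_+$ (nonnegative entries), $\varphi_\gamma:\mathbb{R}^n\times\mathbb{R}^n\times\mathbb{R}^n\to[0,\infty)$ is a function with $\varphi_\gamma(u,v,w)\le\gamma_1\|v-u\|^2+\gamma_2\|w-v\|^2+\gamma_3\|w-u\|^2$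 for all $u,v,w$. For $u\in C$ and $v\in\mathbb{R}^n$, $\mathcal{P}_C(\varphi_\gamma,u,v):=\{w\in C:\langle v-w,y-w\rangle\le\varphi_\gamma(u,v,w)\ \forall y\in C\}$. GInexPM with constant step size. Fix a nonincreasing sequence $(b_k)_{k\in\mathbb{N}}$ of nonnegative reals converging to $0$, a real $b_{-1}>b_0$ with $b_{-1}>0$, and reals $a_k$ with $0\le a_k\le b_{k-1}-b_k$ for all $k\in\mathbb{N}$. Fix constants $\bar\gamma_2<1/2$, $\bar\gamma<1/2$ and a step size $\alpha$ with $0<\alpha<(1-2\bar\gamma)/L$. Start from $x^0\in C$. At iteration $k$: if $\nabla f(x^k)=0$ stop; otherwise choose reals $\gamma_1^k,\gamma_2^k,\gamma_3^k\ge 0$ with $\gamma_1^k+\gamma_2^k\le a_k/\|\nabla f(x^k)\|^2$, $\gamma_2^k<\bar\gamma_2$, $\gamma_3^k<\bar\gamma$, set $\gamma^k=(\gamma_1^k,\gamma_2^k,\gamma_3^k)$, $z^k:=x^k-\alpha\nabla f(x^k)$, and let $x^{k+1}$ be any element of $\mathcal{P}_C(\varphi_{\gamma^k},x^k,z^k)$. ''Infinite sequence generated'' means the algorithm never stops. *)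

(* Defs.v *)
From HB Require Import structures.
From mathcomp Require Import all_boot all_order all_algebra.
From mathcomp Require Import all_classical all_reals all_analysis.

Set Implicit Arguments.
Unset Strict Implicit.
Unset Printing Implicit Defensive.

Import Order.TTheory GRing.Theory Num.Theory.
Import numFieldNormedType.Exports.

Local Open Scope classical_set_scope.
Local Open Scope ring_scope.

(* The library norm `|x| on 'rV[R]_n is the sup norm, so the Euclidean norm is
   defined here.  Topological notions (closed, continuous, differentiable,
   limits, cluster points) are those of the library structure on 'rV[R]_n, which
   coincide with the Euclidean ones. *)
Definition dotv (R : realType) (n : nat) (u v : 'rV[R]_n) : R :=
  \sum_(i < n) u 0 i * v 0 i.

Definition enorm (R : realType) (n : nat) (u : 'rV[R]_n) : R :=
  Num.sqrt (dotv u u).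

Definition grad (R : realType) (n : nat) (f : 'rV[R]_n -> R) (x : 'rV[R]_n) :
    'rV[R]_n :=
  \row_(i < n) 'D_(delta_mx 0 i) f x.

Definition continuously_differentiable (R : realType) (n : nat)
    (f : 'rV[R]_n -> R) : Prop :=
  (forall x, differentiable f x) /\ continuous (grad f).

Definition grad_lipschitz_on (R : realType) (n : nat) (C : set 'rV[R]_n)
    (f : 'rV[R]_n -> R) (L : R) : Prop :=
  forall x y, C x -> C y -> enorm (grad f x - grad f y) <= L * enorm (x - y).

Definition minimizers (R : realType) (n : nat) (C : set 'rV[R]_n)
    (f : 'rV[R]_n -> R) : set 'rV[R]_n :=
  [set x | C x /\ forall y, C y -> f x <= f y].

Definition pseudoconvex (R : realType) (n : nat) (C : set 'rV[R]_n)
    (f : 'rV[R]_n -> R) : Prop :=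
  forall x y, C x -> C y -> 0 <= dotv (grad f y) (x - y) -> f y <= f x.

(* [phi g1 g2 g3 u v w] is $\varphi_\gamma(u,v,w)$ for
   $\gamma = (g_1, g_2, g_3)$; nothing is required of it when some [g_i] is
   negative. *)
Definition error_tolerance (R : realType) (n : nat)
    (phi : R -> R -> R -> 'rV[R]_n -> 'rV[R]_n -> 'rV[R]_n -> R) : Prop :=
  forall g1 g2 g3 : R, 0 <= g1 -> 0 <= g2 -> 0 <= g3 ->
  forall u v w : 'rV[R]_n,
    0 <= phi g1 g2 g3 u v w /\
    phi g1 g2 g3 u v w <= g1 * enorm (v - u) ^+ 2 + g2 * enorm (w - v) ^+ 2
                          + g3 * enorm (w - u) ^+ 2.

Definition inexact_proj (R : realType) (n : nat) (C : set 'rV[R]_n)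
    (phig : 'rV[R]_n -> 'rV[R]_n -> 'rV[R]_n -> R) (u v : 'rV[R]_n) :
    set 'rV[R]_n :=
  [set w | C w /\ forall y, C y -> dotv (v - w) (y - w) <= phig u v w].

(* [bm1] is $b_{-1}$, so the conditional is $b_{k-1}$. *)
Definition forcing_sequences (R : realType) (bm1 : R) (b a : nat -> R) : Prop :=
  [/\ forall k, b k.+1 <= b k,
      forall k, 0 <= b k,
      b k @[k --> \oo] --> (0 : R),
      b 0%N < bm1 /\ 0 < bm1 &
      forall k, 0 <= a k /\ a k <= (if k is k'.+1 then b k' else bm1) - b k].

(* [x] is an infinite run: [grad f (x k) <> 0] says that the stopping test fails
   at every iteration. *)
Definition GInexPM_run (R : realType) (n : nat) (C : set 'rV[R]_n)
    (f : 'rV[R]_n -> R)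
    (phi : R -> R -> R -> 'rV[R]_n -> 'rV[R]_n -> 'rV[R]_n -> R)
    (a : nat -> R) (gbar2 gbar alpha : R) (x : nat -> 'rV[R]_n) : Prop :=
  C (x 0%N) /\
  forall k, grad f (x k) <> 0 /\
    exists g1 g2 g3 : R,
      [/\ [/\ 0 <= g1, 0 <= g2 & 0 <= g3],
          g1 + g2 <= a k / enorm (grad f (x k)) ^+ 2,
          g2 < gbar2,
          g3 < gbar &
          inexact_proj C (phi g1 g2 g3) (x k) (x k - alpha *: grad f (x k))
            (x k.+1)].

(* Main.v *)
Require Import Defs.
From HB Require Import structures.
From mathcomp Require Import all_boot all_order all_algebra.
From mathcomp Require Import all_classical all_reals all_analysis.
From mathcomp Require Import ring lra.

Import Order.TTheory GRing.Theory Num.Theory.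
Import numFieldNormedType.Exports.

Local Open Scope classical_set_scope.
Local Open Scope ring_scope.

(** The argument is that of quasi-Fejer monotone sequences.  Write b_(-1) = [bm1],
    [B k] = b_(k-1), [g k] for the gradient at [x k], and
    [F k = f (x k) + c * B k] with [c = alpha / (1 - 2 * gbar2)].

    The variational inequality defining the inexact projection, together with
    the descent lemma for functions with Lipschitz gradient, yields two
    estimates for one iteration.  Testing with the current iterate gives
    |x_(k+1) - x_k|^2 <= 2 alpha (F_k - F_(k+1)) ([sufficient_decrease]): the
    function values decrease up to the error [c * a k], and since
    [a k <= B k - B k.+1] these errors telescope, so [F] is nonincreasing.
    Testing with an arbitrary y in C gives ([quasi_fejer_step])
      |x_(k+1) - y|^2 - |x_k - y|^2
        <= 4 alpha (F_k - F_(k+1)) + 2 alpha^2 (B_k - B_(k+1))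
           + 2 alpha <g_k, y - x_k>.

    Consequently, with
      V_y(k) = |x_k - y|^2 + 4 alpha F_k + 2 alpha^2 B_k,
    the sequence V_y decreases at every step where <g_k, y - x_k> <= 0, and
    pseudoconvexity guarantees this as soon as f(y) <= f(x_k)
    ([pseudoconvex_dotv_grad_le0]).

    - Every cluster point p is a minimizer ([cluster_minimizer]).  [F] is
      nonincreasing and tends to f(p) along a subsequence, hence it converges,
      hence the steps x_(k+1) - x_k tend to 0.  Passing to the limit in the
      second estimate along the subsequence leaves 0 <= <grad f(p), y - p> for
      all y in C, and pseudoconvexity turns this into f(p) <= f(y).
    - If some y in C satisfies f(y) <= f(x_k) for all large k, then V_y bounds
      the iterates and there is a cluster point ([lower_level_cluster]).  A
      minimizer is such a y.
    - If p is a cluster point, V_p is nonincreasing and tends to 4 alpha f(p)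
      along a subsequence, hence converges to it; as F_k >= f(p), this forces
      |x_k - p| to 0 ([cluster_minimizer_cvg]).
    - Without minimizers there is no cluster point, so the norms diverge, and no
      y in C can stay below the iterates, so f(x_k) tends to the infimum
      ([cvg_ereal_inf]). *)

Set Implicit Arguments.
Unset Strict Implicit.
Unset Printing Implicit Defensive.

(** * The Euclidean inner product *)

Section euclidean.
Context {R : realType} {n : nat}.
Implicit Types (u v w : 'rV[R]_n) (t : R).

Lemma dotvC u v : dotv u v = dotv v u.
Proof. by apply: eq_bigr => i _; rewrite mulrC. Qed.

Lemma dotvDl u v w : dotv (u + v) w = dotv u w + dotv v w.
Proof. by rewrite -big_split; apply: eq_bigr => i _; rewrite mxE mulrDl. Qed.

Lemma dotvZl t u w : dotv (t *: u) w = t * dotv u w.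
Proof. by rewrite /dotv mulr_sumr; apply: eq_bigr => i _; rewrite mxE mulrA. Qed.

Lemma dotvNl u w : dotv (- u) w = - dotv u w.
Proof. by rewrite -scaleN1r dotvZl mulN1r. Qed.

Lemma dotvDr u v w : dotv w (u + v) = dotv w u + dotv w v.
Proof. by rewrite dotvC dotvDl !(dotvC w). Qed.

Lemma dotvZr t u w : dotv w (t *: u) = t * dotv w u.
Proof. by rewrite dotvC dotvZl (dotvC w). Qed.

Lemma dotvNr u w : dotv w (- u) = - dotv w u.
Proof. by rewrite dotvC dotvNl (dotvC w). Qed.

Definition dotvE := (dotvDl, dotvDr, dotvNl, dotvNr, dotvZl, dotvZr).

Lemma dotvv_ge0 u : 0 <= dotv u u.
Proof. by apply: sumr_ge0 => i _; rewrite -expr2 sqr_ge0. Qed.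

Lemma sqr_enorm u : enorm u ^+ 2 = dotv u u.
Proof. by rewrite sqr_sqrtr// dotvv_ge0. Qed.

Lemma enorm_ge0 u : 0 <= enorm u.
Proof. exact: sqrtr_ge0. Qed.

Lemma enormN u : enorm (- u) = enorm u.
Proof. by rewrite /enorm dotvNl dotvNr opprK. Qed.

Lemma enormZ t u : 0 <= t -> enorm (t *: u) = t * enorm u.
Proof.
move=> t0; rewrite /enorm dotvZl dotvZr mulrA -expr2 sqrtrM ?sqr_ge0//.
by rewrite sqrtr_sqr ger0_norm.
Qed.

Lemma sqr_coord_le_dotvv u (i : 'I_n) : u 0 i ^+ 2 <= dotv u u.
Proof.
rewrite /dotv (bigD1 i)//= expr2 lerDl.
by apply: sumr_ge0 => j _; rewrite -expr2 sqr_ge0.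
Qed.

Lemma mx_norm_le_enorm u : `|u| <= enorm u.
Proof.
have [->|u0] := eqVneq u 0; first by rewrite normr0 enorm_ge0.
have [[i0 i] /= ->] : exists i, `|u| = `|u i.1 i.2|.
  by apply: mx_norm_neq0; apply: contra_neq u0 => /mx_norm_eq0.
rewrite (ord1 i0) -sqrtr_sqr ler_sqrt ?dotvv_ge0//.
exact: sqr_coord_le_dotvv.
Qed.

Lemma enorm_eq0 u : enorm u = 0 -> u = 0.
Proof.
move=> u0; apply/eqP; rewrite -normr_le0 -u0; exact: mx_norm_le_enorm.
Qed.

(** Expanding 0 <= | |v| u - |u| v |^2 gives |u| |v| <u, v> <= (|u| |v|)^2. *)
Lemma dotv_le_enorm u v : dotv u v <= enorm u * enorm v.
Proof.
have [/enorm_eq0 ->|u0] := eqVneq (enorm u) 0.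
  by rewrite -(scale0r 0) dotvZl mul0r mulr_ge0// enorm_ge0.
have [/enorm_eq0 ->|v0] := eqVneq (enorm v) 0.
  by rewrite -(scale0r 0) dotvZr mul0r mulr_ge0// enorm_ge0.
have uv_gt0 : 0 < enorm u * enorm v.
  by rewrite mulr_gt0// lt_neqAle enorm_ge0 eq_sym ?u0 ?v0.
rewrite -(ler_pM2l uv_gt0).
have := dotvv_ge0 (enorm v *: u - enorm u *: v).
rewrite !dotvE (dotvC v u) -!sqr_enorm; lra.
Qed.
End euclidean.

(** * Calculus along segments *)

Section calculus_on_segments.
Context {R : realType} {n : nat}.
Variables (C : set 'rV[R]_n) (f : 'rV[R]_n -> R).
Hypothesis C_convex : convex_set C.
Hypothesis f_diff : forall x, differentiable f x.

Lemma segment_in_convex x y t : C x -> C y -> 0 <= t -> t <= 1 ->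
  C (x + t *: (y - x)).
Proof.
move=> Cx Cy t0 t1; have := @C_convex y x (Itv01 t0 t1).
rewrite !inE => /(_ Cy Cx); congr C.
rewrite [LHS]/(t *: y + (1 - t) *: x).
by rewrite scalerBl scale1r scalerBr addrCA.
Qed.

(** [grad] collects the partial derivatives; linearity of the differential makes
    it represent every directional derivative. *)
Lemma deriveE_grad x d : 'D_d f x = dotv (grad f x) d.
Proof.
rewrite deriveE// [in LHS](row_sum_delta d) linear_sum /dotv.
by apply: eq_bigr => i _; rewrite linearZ mxE deriveE// mulrC.
Qed.

Lemma is_derive_line x d (t : R) :
  is_derive t 1 (fun s : R => f (x + s *: d)) (dotv (grad f (x + t *: d)) d).
Proof.
pose q (h : R) := h^-1 *: ((f \o shift (x + t *: d)) (h *: d) - f (x + t *: d)).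
have shiftE : (fun h : R => h^-1 *:
    (((fun s : R => f (x + s *: d)) \o shift t) (h *: 1) - f (x + t *: d))) = q.
  apply/funext => h; rewrite /q /=; congr (_ *: (f _ - _)).
  by rewrite [h *: 1]mulr1 scalerDl addrCA.
rewrite -deriveE_grad; apply: DeriveDef; rewrite /derivable /derive shiftE//.
exact: diff_derivable.
Qed.

Lemma continuous_line x d : continuous (fun s : R => f (x + s *: d)).
Proof.
move=> t; apply: differentiable_continuous; rewrite -derivable1_diffP.
by have [] := is_derive_line x d t.
Qed.

(** The defect [h] between [f] and its quadratic upper model along the segment
    has nonpositive derivative, by Cauchy-Schwarz and the Lipschitz bound. *)
Lemma descent_lemma L x y : grad_lipschitz_on C f L -> C x -> C y ->
  f y <= f x + dotv (grad f x) (y - x) + L / 2 * enorm (y - x) ^+ 2.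
Proof.
move=> f_lip Cx Cy; set d := y - x.
pose h (t : R) := f (x + t *: d) - t * dotv (grad f x) d
                  - t ^+ 2 * (L / 2 * enorm d ^+ 2).
pose dh (t : R) := dotv (grad f (x + t *: d)) d - dotv (grad f x) d
                  - t * (L * enorm d ^+ 2).
have h_derive (t : R) : is_derive t (1 : R) h (dh t).
  have fd := is_derive_line x d t.
  have -> : h = (fun s : R => f (x + s *: d)) - (dotv (grad f x) d *: id)
                - (L / 2 * enorm d ^+ 2) *: (id ^+ 2 : R -> R).
    by apply/funext => s; rewrite /h !fctE; congr (_ - _ - _); exact: mulrC.
  apply: is_derive_eq.
  have scaleE (k s : R) : k *: s = k * s by [].
  by rewrite /dh expr1 !scaleE !mulr1; field.
have [|t /andP[]] := @MVT R h dh 0 1 ltr01 (fun t _ => h_derive t).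
  apply: continuous_subspaceT => t; apply: differentiable_continuous.
  by rewrite -derivable1_diffP; have [] := h_derive t.
rewrite !bnd_simp => t0 t1.
rewrite /h scale1r scale0r addr0 subrKC expr0n mul0r mul0r expr1n.
rewrite !mul1r !subr0 mulr1.
suff : dh t <= 0 by lra.
have := dotv_le_enorm (grad f (x + t *: d) - grad f x) d.
have := f_lip _ _ (segment_in_convex Cx Cy (ltW t0) (ltW t1)) Cx.
rewrite -/d [x + _ - x]addrAC subrr add0r enormZ; last exact: ltW.
move=> lip.
have := ler_wpM2r (enorm_ge0 d) lip.
rewrite dotvDl dotvNl /dh; lra.
Qed.

(** A pseudoconvex function is quasiconvex.  If the maximum of [f] over the
    segment [x, y] were attained in the interior with a value above [f x], the
    derivative along the segment would vanish there, and pseudoconvexity would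
    make that point a minimum over the segment. *)
Lemma pseudoconvex_segment x y t : pseudoconvex C f -> C x -> C y ->
  f y <= f x -> 0 <= t -> t <= 1 -> f (x + t *: (y - x)) <= f x.
Proof.
move=> f_pseudo Cx Cy fyx t0 t1; set d := y - x.
pose h (s : R) := f (x + s *: d).
have [s sI hmax] := @EVT_max R h 0 1 ler01
  (continuous_subspaceT (@continuous_line x d)).
have hts : h t <= h s by apply: hmax; rewrite in_itv/= t0.
apply: (le_trans hts); rewrite leNgt; apply/negP => fxs.
have s0 : s != 0 by apply: contraTneq fxs => ->; rewrite /h scale0r addr0 ltxx.
have s1 : s != 1.
  by apply: contraTneq fxs => ->; rewrite /h scale1r subrKC -leNgt.
have sI' : s \in `]0, 1[.
  by move: sI; rewrite !in_itv/= !lt_neqAle s1 eq_sym s0.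
have h0 : is_derive s (1 : R) h 0.
  apply: (derive1_at_max ler01 _ sI').
    by move=> u _; have [] := is_derive_line x d u.
  by move=> u; rewrite in_itv/= => /andP[u0 u1]; apply: hmax;
    rewrite in_itv/= !ltW.
have d0 : dotv (grad f (x + s *: d)) d = 0.
  have hs := is_derive_line x d s.
  by rewrite -(@derive_val _ _ _ _ _ _ _ h0) (@derive_val _ _ _ _ _ _ _ hs).
move: sI; rewrite in_itv/= => /andP[s_ge0 s_le1].
have := f_pseudo x _ Cx (segment_in_convex Cx Cy s_ge0 s_le1).
rewrite -/d opprD addNKr dotvNr dotvZr d0 mulr0 oppr0 => /(_ (lexx _)).
by rewrite leNgt fxs.
Qed.

(** The difference quotients of [f] at [x] towards [y] are nonpositive by
    quasiconvexity, and so is their limit. *)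
Lemma pseudoconvex_dotv_grad_le0 x y : pseudoconvex C f -> C x -> C y ->
  f y <= f x -> dotv (grad f x) (y - x) <= 0.
Proof.
move=> f_pseudo Cx Cy fyx; set d := y - x.
pose h (s : R) := f (x + s *: d).
have [hd] := is_derive_line x d 0; rewrite scale0r addr0 => <-.
rewrite ['D_(1 : R) _ 0]cvg_at_rightE; last exact: hd.
apply: limr_le.
  have := hd; rewrite /derivable => dh.
  rewrite -(cvg_at_rightE (fun r : R => r^-1 *: ((h \o shift 0) (r *: 1) - h 0))) //.
  apply: cvg_trans dh; apply: cvg_app.
  move=> A [e egt0 Ae]; exists e => // r re rgt0; apply: Ae => //.
  exact/lt0r_neq0.
near=> r.
have r_gt0 : 0 < r by [].
have r_le1 : r <= 1 by near: r; apply: nbhs_right_le.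
rewrite /= addr0 scale0r addr0 pmulr_rle0 ?invr_gt0// subr_le0.
rewrite [_%:A]mulr1.
exact: pseudoconvex_segment (ltW r_gt0) _.
Unshelve. all: by end_near.
Qed.
End calculus_on_segments.

(** * Estimates for one iteration *)

Section one_iteration.
Context {R : realType} {n : nat}.
Variables (C : set 'rV[R]_n) (f : 'rV[R]_n -> R) (L : R).
Variables (gbar2 gbar alpha : R).
Hypothesis C_convex : convex_set C.
Hypothesis f_diff : forall x, differentiable f x.
Hypothesis f_lip : grad_lipschitz_on C f L.
Hypotheses (L_gt0 : 0 < L) (alpha_gt0 : 0 < alpha).
Hypotheses (gbar2_lt : gbar2 < 1 / 2) (gbar_lt : gbar < 1 / 2).
Hypothesis alpha_lt : alpha < (1 - 2 * gbar) / L.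

Variables (phig : 'rV[R]_n -> 'rV[R]_n -> 'rV[R]_n -> R) (ak g1 g2 g3 : R).
Variables x w : 'rV[R]_n.
Let g := grad f x.
Hypotheses (g1_ge0 : 0 <= g1) (g2_ge0 : 0 <= g2) (g3_ge0 : 0 <= g3).
Hypotheses (g2_lt : g2 < gbar2) (g3_lt : g3 < gbar).
Hypothesis g_neq0 : g <> 0.
Hypothesis g12_le : g1 + g2 <= ak / enorm g ^+ 2.
Hypothesis phig_le : forall u v z, phig u v z <=
  g1 * enorm (v - u) ^+ 2 + g2 * enorm (z - v) ^+ 2 + g3 * enorm (z - u) ^+ 2.
Hypotheses (Cx : C x) (w_proj : inexact_proj C phig x (x - alpha *: g) w).

Let D := enorm (w - x) ^+ 2.
Let c := alpha / (1 - 2 * gbar2).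

Let parameter_bounds :
  [/\ [/\ 0 <= g2, g2 < gbar2 & gbar2 < 1 / 2],
      [/\ 0 <= g3, g3 < gbar & gbar < 1 / 2] & 0 < alpha].
Proof. by do 2?split. Qed.

Let ak_ge : (g1 + g2) * enorm g ^+ 2 <= ak.
Proof.
have g_gt0 : 0 < enorm g ^+ 2.
  rewrite exprn_gt0// lt_neqAle enorm_ge0 andbT eq_sym.
  by apply/eqP => /enorm_eq0.
by rewrite -ler_pdivlMr.
Qed.

Let ak_ge0 : 0 <= ak.
Proof.
by apply: le_trans ak_ge; rewrite mulr_ge0 ?sqr_ge0// addr_ge0.
Qed.

(** Expanding the tolerance around [x], the terms quadratic in the gradient
    combine to (g1 + g2) alpha^2 |g|^2, which the choice of the parameters bounds
    by alpha^2 [ak]; only the step and its inner product with [g] remain. *)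
Lemma inexact_proj_variational y : C y ->
  dotv (x - alpha *: g - w) (y - w) <=
  alpha ^+ 2 * ak + (g2 + g3) * D + 2 * alpha * g2 * dotv g (w - x).
Proof.
have [_ /[apply] /le_trans] := w_proj; apply.
apply: (le_trans (phig_le _ _ _)).
have -> : x - alpha *: g - x = - (alpha *: g) by rewrite addrAC subrr add0r.
have -> : w - (x - alpha *: g) = (w - x) + alpha *: g.
  by rewrite opprB addrA addrAC.
rewrite -/D [enorm (- _) ^+ 2]sqr_enorm [enorm (_ + _) ^+ 2]sqr_enorm.
rewrite !(dotvDl (w - x)) !(dotvDr (w - x)) !dotvNl !dotvNr !dotvZl !dotvZr.
rewrite -!sqr_enorm -/D (dotvC (w - x) g).
have := ler_wpM2l (sqr_ge0 alpha) ak_ge; lra.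
Qed.

Let aL : alpha * L <= 1 - 2 * gbar.
Proof. by rewrite -ler_pdivlMr// ltW. Qed.

(** The variational inequality at [y = x] bounds <g, w - x> from above by
    [c * ak - (1 - gbar) / alpha * D]; in the descent lemma the term
    [L / 2 * D] absorbs at most [(1 / 2 - gbar) / alpha * D] of the decrease,
    because [alpha * L <= 1 - 2 * gbar]. *)
Lemma sufficient_decrease : D <= 2 * alpha * (f x - f w + c * ak).
Proof.
have [[? ? ?] [? ? ?] ?] := parameter_bounds.
have Cw : C w by case: w_proj.
have := descent_lemma C_convex f_diff f_lip Cx Cw.
have := inexact_proj_variational Cx.
rewrite -/D -/g; set p := dotv g (w - x).
have -> : x - alpha *: g - w = - (w - x) - alpha *: g.
  by rewrite opprB addrAC.
have -> : x - w = - (w - x) by rewrite opprB.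
rewrite dotvDl !dotvNl !dotvNr dotvZl opprK -sqr_enorm -/D -/p.
move=> var desc.
have D_ge0 : 0 <= D by exact: sqr_ge0.
have k_gt0 : 0 < 1 - 2 * g2 by lra.
have c_ge : alpha * ak <= (1 - 2 * g2) * (c * ak).
  rewrite mulrA ler_wpM2r// /c mulrA ler_pdivlMr; last by lra.
  by have := ler_wpM2l (ltW alpha_gt0) (ltW g2_lt); lra.
(* (1 - 2 g2) (1 - g3) <= 1 - g2 - g3, the difference being g2 (1 - 2 g3) *)
have kp : (1 - 2 * g2) * (alpha * p)
    <= (1 - 2 * g2) * (alpha * (c * ak) - (1 - g3) * D).
  have := ler_wpM2l (ltW alpha_gt0) c_ge.
  have : 0 <= g2 * (1 - 2 * g3) * D.
    by rewrite mulr_ge0//; rewrite mulr_ge0//; lra.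
  lra.
rewrite ler_pM2l// in kp.
have := ler_wpM2r D_ge0 aL.
have := ler_wpM2l (ltW alpha_gt0) desc.
have := ler_wpM2r D_ge0 (ltW g3_lt).
lra.
Qed.

(** The multiple of <g, x - w> left by the variational inequality at [y] is
    bounded by the decrease of [f] through the descent lemma.  What then remains
    of [D] has a coefficient at most [4 * gbar * g2 <= 1], and
    [sufficient_decrease] converts it into decrease of [f], which doubles the
    constant in front of that term to [4 * alpha]. *)
Lemma quasi_fejer_step y : C y ->
  enorm (w - y) ^+ 2 - enorm (x - y) ^+ 2 <=
  4 * alpha * (f x - f w + c * ak) + 2 * alpha ^+ 2 * ak
  + 2 * alpha * dotv g (y - x).
Proof.
move=> Cy; have [[? ? ?] [? ? ?] ?] := parameter_bounds.
have Cw : C w by case: w_proj.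
have := descent_lemma C_convex f_diff f_lip Cx Cw.
have := inexact_proj_variational Cy.
have := sufficient_decrease.
rewrite -/D -/g; set p := dotv g (w - x).
have -> : x - alpha *: g - w = - (w - x) - alpha *: g.
  by rewrite opprB addrAC.
have -> : y - w = (y - x) - (w - x) by rewrite opprB addrA subrK.
have -> : w - y = (w - x) - (y - x) by rewrite opprB addrA subrK.
have -> : enorm (x - y) = enorm (y - x) by rewrite -enormN opprB.
rewrite [enorm (_ - (y - x)) ^+ 2]sqr_enorm [enorm (y - x) ^+ 2]sqr_enorm.
rewrite (dotvDl (w - x)) (dotvDl (- (w - x))) !dotvNl dotvZl.
rewrite !(dotvDr (w - x)) !(dotvDr (y - x)) !dotvNr.
rewrite -!sqr_enorm -/D -/p (dotvC (y - x)).
set Q := f x - f w + c * ak.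
move=> decr var desc.
have D_ge0 : 0 <= D by exact: sqr_ge0.
have k_gt0 : 0 < 1 - 2 * g2 by lra.
have cak_ge0 : 0 <= c * ak by rewrite mulr_ge0// divr_ge0//; lra.
(* Q, the decrease of f up to the error, is nonnegative and dominates f x - f w *)
have desc' : - p <= Q + L / 2 * D by rewrite /Q; lra.
have := ler_wpM2l (ltW (mulr_gt0 alpha_gt0 k_gt0)) desc'.
have := ler_wpM2r (mulr_ge0 (ltW k_gt0) D_ge0) aL.
have : 0 <= alpha * Q by lra.
move=> aQ; have := mulr_ge0 g2_ge0 aQ.
have : 0 <= (gbar - g3) * D by rewrite mulr_ge0//; lra.
have : 0 <= (1 / 2 - gbar) * g2 * D by rewrite mulr_ge0//; rewrite mulr_ge0//; lra.
have : 0 <= (1 / 2 - g2) * D by rewrite mulr_ge0//; lra.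
lra.
Qed.
End one_iteration.

(** * Sequences in Euclidean space *)

Section euclidean_topology.
Context {R : realType} {n : nat}.

Lemma cvg_dotv {T : Type} {F : set_system T} {FF : Filter F}
    (u v : T -> 'rV[R]_n) (p q : 'rV[R]_n) :
  u @ F --> p -> v @ F --> q -> dotv (u t) (v t) @[t --> F] --> dotv p q.
Proof.
move=> up vq; apply: cvg_big => [|i _]; first exact: add_continuous.
apply: cvgM.
  exact: (cvg_comp _ _ up (@coord_continuous _ _ _ 0 i p)).
exact: (cvg_comp _ _ vq (@coord_continuous _ _ _ 0 i q)).
Qed.

(** The topology comes from the sup norm, which the Euclidean norm dominates. *)
Lemma cvg_sqr_enorm0 {T : Type} {F : set_system T} {FF : Filter F}
    (u : T -> 'rV[R]_n) (p : 'rV[R]_n) :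
  enorm (u t - p) ^+ 2 @[t --> F] --> (0 : R) -> u @ F --> p.
Proof.
move=> up; apply/subr_cvg0/norm_cvg0P/cvgrPdist_lt => e e0.
move/cvgrPdist_lt : up => /(_ _ (exprn_gt0 2 e0)).
apply: filterS => t; rewrite !sub0r !normrN normr_id.
rewrite ger0_norm ?sqr_ge0// ltr_pXn2r// ?nnegrE ?enorm_ge0//; last exact: ltW.
exact: le_lt_trans (mx_norm_le_enorm _).
Qed.

(** Pick an index [m j >= j] with [u (m j)] in the ball of radius 1/(j+1); then
    [m] tends to infinity by comparison with the identity. *)
Lemma cluster_subsequence (u : nat -> 'rV[R]_n) (p : 'rV[R]_n) :
  cluster (u @ \oo) p ->
  exists m : nat -> nat, m @ \oo --> \oo /\ u (m j) @[j --> \oo] --> p.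
Proof.
move=> up.
have /choice [m mP] : forall j, exists k, (j <= k)%N /\ `|p - u k| < j.+1%:R^-1.
  move=> j.
  have [||q [[k /= jk <-]]] := up (u @` [set k | (j <= k)%N]) (ball p j.+1%:R^-1).
  - by exists j => // k /= jk; exists k.
  - by apply: nbhsx_ballx; rewrite invr_gt0.
  - by rewrite -ball_normE; exists k.
exists m; split.
  apply/cvgnyPge => A; exists A => // j /= Aj.
  by apply: leq_trans Aj _; have [] := mP j.
apply/cvgrPdist_lt => e e0; have := near_infty_natSinv_lt (PosNum e0).
by apply: filterS => j; apply: lt_trans; have [] := mP j.
Qed.

(** Bolzano-Weierstrass, with boundedness required only along infinitely many
    indices so that its contrapositive gives divergence of the norms. *)
Lemma bounded_subsequence_cluster (u : nat -> 'rV[R]_n) (M : R) :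
  (forall N, exists2 k, (N <= k)%N & enorm (u k) <= M) ->
  cluster (u @ \oo) !=set0.
Proof.
move=> bnd.
have /choice[m mP] : forall N, exists k, (N <= k)%N /\ enorm (u k) <= M.
  by move=> N; have [k] := bnd N; exists k.
have um_cpt := @rV_compact R n (fun=> `[- M, M]%classic)
  (fun=> @segment_compact R _ _).
have [|p [_ pm]] := um_cpt ((u \o m) @ \oo) _.
  exists 0%N => // j _ i /=; rewrite in_itv/= -ler_norml -sqrtr_sqr.
  apply: le_trans (mP j).2; rewrite ler_sqrt ?dotvv_ge0//.
  exact: sqr_coord_le_dotvv.
exists p => A U [N _ uA] pU; apply: pm pU.
by exists N => // j /= Nj; apply: uA; rewrite /= (leq_trans Nj)// (mP j).1.
Qed.

Lemma nonincreasing_subsequence_cvg (u : nat -> R) (m : nat -> nat) (l : R) :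
  nonincreasing_seq u -> m @ \oo --> \oo -> u (m j) @[j --> \oo] --> l ->
  u @ \oo --> l /\ forall k, l <= u k.
Proof.
move=> u_ni m_oo um.
have l_le k : l <= u k.
  apply: (ler_cvg_to um (cvg_cst (u k))).
  by move/cvgnyPge : m_oo => /(_ k); apply: filterS => j; exact: u_ni.
split=> //; apply/cvgrPdist_lt => e e0.
move/cvgrPdist_lt : um => /(_ _ e0) [j0 _ /(_ j0 (leqnn _))].
rewrite distrC ger0_norm ?subr_ge0// => um_lt.
exists (m j0) => // k /= jk; rewrite distrC ger0_norm ?subr_ge0//.
by apply: le_lt_trans um_lt; rewrite lerB// u_ni.
Qed.
End euclidean_topology.

(** * Convergence of quasi-Fejer sequences *)

Section asymptotics.
Context {R : realType} {n : nat}.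
Variables (C : set 'rV[R]_n) (f : 'rV[R]_n -> R).
Variables (alpha c : R) (B : nat -> R) (x : nat -> 'rV[R]_n).
Hypotheses (C_closed : closed C) (C_convex : convex_set C).
Hypotheses (f_C1 : continuously_differentiable f) (f_pseudo : pseudoconvex C f).
Hypotheses (alpha_gt0 : 0 < alpha) (c_ge0 : 0 <= c).
Hypotheses (B_ni : nonincreasing_seq B) (B_cvg0 : B @ \oo --> (0 : R)).
Hypothesis Cx : forall k, C (x k).

(** The error term [c * B k] makes the values of [f] along the sequence
    monotone. *)
Let F k := f (x k) + c * B k.

Hypothesis decrease : forall k,
  enorm (x k.+1 - x k) ^+ 2 <= 2 * alpha * (F k - F k.+1).
Hypothesis quasi_fejer : forall y k, C y ->
  enorm (x k.+1 - y) ^+ 2 - enorm (x k - y) ^+ 2 <=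
  4 * alpha * (F k - F k.+1) + 2 * alpha ^+ 2 * (B k - B k.+1)
  + 2 * alpha * dotv (grad f (x k)) (y - x k).

Let f_diff : forall z, differentiable f z.
Proof. by case: f_C1. Qed.

Let B_ge0 k : 0 <= B k.
Proof. exact: (nonincreasing_subsequence_cvg B_ni (@cvg_id _ _) B_cvg0).2. Qed.

Let F_ni : nonincreasing_seq F.
Proof.
apply/nonincreasing_seqP => k; rewrite -subr_ge0.
have al2 : 0 < 2 * alpha by rewrite mulr_gt0.
by rewrite -(pmulr_rge0 _ al2); apply: le_trans (decrease k); exact: sqr_ge0.
Qed.

Let f_le_F k : f (x k) <= F k.
Proof. by rewrite lerDl mulr_ge0. Qed.

Lemma perturbed_value_cvg m p : m @ \oo --> \oo -> x (m j) @[j --> \oo] --> p ->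
  F @ \oo --> f p /\ forall k, f p <= F k.
Proof.
move=> m_oo xm; apply: nonincreasing_subsequence_cvg F_ni (m_oo) _.
rewrite -[f p]addr0 -(mulr0 c); apply: cvgD.
  exact: (cvg_comp _ _ xm (differentiable_continuous (f_diff p))).
by apply: cvgMl_tmp; exact: (cvg_comp _ _ m_oo B_cvg0).
Qed.

(** [quasi_fejer], in the limit along a subsequence tending to [p], is the
    first-order optimality condition at [p]. *)
Lemma cluster_minimizer p : cluster (x @ \oo) p -> minimizers C f p.
Proof.
move=> /cluster_subsequence[m [m_oo xm]].
have Cp : C p by apply: (@closed_cvg _ _ _ _ _ C C_closed _ p xm); exact: nearW.
split=> // y Cy; apply: f_pseudo => //.
have [F_cvg _] := perturbed_value_cvg m_oo xm.
have dF : F k - F k.+1 @[k --> \oo] --> (0 : R).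
  rewrite -(subrr (f p)); apply: cvgB => //; by rewrite (cvg_shiftS F).
have dFm : F (m j) - F (m j).+1 @[j --> \oo] --> (0 : R).
  exact: (cvg_comp _ _ m_oo dF).
have dB : B k - B k.+1 @[k --> \oo] --> (0 : R).
  rewrite -(subrr 0); apply: cvgB => //; by rewrite (cvg_shiftS B).
have dBm : B (m j) - B (m j).+1 @[j --> \oo] --> (0 : R).
  exact: (cvg_comp _ _ m_oo dB).
have xSm : x (m j).+1 @[j --> \oo] --> p.
  have d0 : (fun j => x (m j).+1 - x (m j)) @ \oo --> (0 : 'rV[R]_n).
    apply: cvg_sqr_enorm0; under eq_fun do rewrite subr0.
    apply: (squeeze_cvgr _ (cvg_cst 0)); last first.
      rewrite -(mulr0 (2 * alpha)); exact: (cvgMl_tmp (a := 2 * alpha) dFm).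
    by apply: nearW => j; rewrite sqr_ge0 decrease.
  have -> : (fun j => x (m j).+1) =
      (fun j => (x (m j).+1 - x (m j)) + x (m j)).
    by apply/funext => j; rewrite subrK.
  by rewrite -[p]add0r; exact: cvgD.
have lhs : enorm (x (m j).+1 - y) ^+ 2 - enorm (x (m j) - y) ^+ 2
    @[j --> \oo] --> (0 : R).
  rewrite -(subrr (dotv (p - y) (p - y))); under eq_fun do rewrite !sqr_enorm.
  by apply: cvgB; apply: cvg_dotv; apply: cvgB => //; exact: cvg_cst.
have rhs : 4 * alpha * (F (m j) - F (m j).+1)
    + 2 * alpha ^+ 2 * (B (m j) - B (m j).+1)
    + 2 * alpha * dotv (grad f (x (m j))) (y - x (m j)) @[j --> \oo] -->
    4 * alpha * 0 + 2 * alpha ^+ 2 * 0 + 2 * alpha * dotv (grad f p) (y - p).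
  apply: cvgD; first by apply: cvgD; exact: cvgMl_tmp.
  apply: cvgMl_tmp; apply: cvg_dotv; last by apply: cvgB => //; exact: cvg_cst.
  exact: (cvg_comp _ _ xm (proj2 f_C1 p)).
have : 0 <= 4 * alpha * 0 + 2 * alpha ^+ 2 * 0
            + 2 * alpha * dotv (grad f p) (y - p).
  by apply: (ler_cvg_to lhs rhs); apply: nearW => j; exact: quasi_fejer.
by rewrite !mulr0 !add0r pmulr_rge0// mulr_gt0.
Qed.

(** The two telescoping error terms of [quasi_fejer] are added to the
    squared distance, so that only the sign of <grad f (x k), y - x k> decides
    whether [V y] decreases. *)
Let V y k := enorm (x k - y) ^+ 2 + 4 * alpha * F k + 2 * alpha ^+ 2 * B k.

Lemma potential_nonincreasing y k : C y -> f y <= f (x k) -> V y k.+1 <= V y k.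
Proof.
move=> Cy fyx.
have := quasi_fejer k Cy.
have := pseudoconvex_dotv_grad_le0 C_convex f_diff f_pseudo (Cx k) Cy fyx.
move=> g_le0; have := mulr_ge0_le0 (ltW alpha_gt0) g_le0.
rewrite /V; lra.
Qed.

(** [V y] is nonincreasing from [N] on and its last two terms are bounded below
    by [4 * alpha * f y], so the squared distances to [y] are bounded. *)
Lemma lower_level_cluster y N : C y ->
  (forall k, (N <= k)%N -> f y <= f (x k)) -> cluster (x @ \oo) !=set0.
Proof.
move=> Cy fyx.
have V_le k : V y (N + k) <= V y N.
  elim: k => [|k IH]; first by rewrite addn0.
  by rewrite addnS (le_trans (potential_nonincreasing Cy _) IH)// fyx// leq_addr.
set M := V y N - 4 * alpha * f y.
apply: (@bounded_subsequence_cluster _ _ x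
  (Num.sqrt (2 * M + 2 * dotv y y))) => N'.
exists (N + N')%N; first exact: leq_addl.
apply: ler_wsqrtr; set z := x (N + N')%N.
(* z is shifted by y: |(z - y) + y|^2 <= 2 |z - y|^2 + 2 |y|^2 *)
have z_le : dotv (z - y) (z - y) <= M.
  have := ler_wpM2l (ltW alpha_gt0) (le_trans (fyx _ (leq_addr N' N)) (f_le_F _)).
  have := mulr_ge0 (sqr_ge0 alpha) (B_ge0 (N + N')).
  have := V_le N'; rewrite /M {1}/V -/z sqr_enorm; lra.
have := dotvv_ge0 (z - y - y); have : z = (z - y) + y by rewrite subrK.
move: (z - y) z_le => d d_le ->; rewrite !dotvE (dotvC y d); lra.
Qed.

(** [V p] converges to its limit [4 * alpha * f p] along a subsequence, and
    [F k >= f p], so nothing is left for the squared distance to [p]. *)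
Lemma cluster_minimizer_cvg p : cluster (x @ \oo) p -> x @ \oo --> p.
Proof.
move=> xp; have [Cp p_min] := cluster_minimizer xp.
have [m [m_oo xm]] := cluster_subsequence xp.
have [F_cvg F_ge] := perturbed_value_cvg m_oo xm.
have V_ni : nonincreasing_seq (V p).
  apply/nonincreasing_seqP => k; apply: potential_nonincreasing => //.
  exact: p_min.
have Vm : V p (m j) @[j --> \oo] --> 4 * alpha * f p.
  have -> : 4 * alpha * f p =
      dotv (p - p) (p - p) + 4 * alpha * f p + 2 * alpha ^+ 2 * 0.
    by rewrite mulr0 addr0 subrr -{1}(scale0r 0) dotvZl mul0r add0r.
  apply: cvgD; last by apply: cvgMl_tmp; exact: (cvg_comp _ _ m_oo B_cvg0).
  apply: cvgD; last by apply: cvgMl_tmp; exact: (cvg_comp _ _ m_oo F_cvg).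
  under eq_fun do rewrite sqr_enorm.
  by apply: cvg_dotv; apply: cvgB => //; exact: cvg_cst.
have [V_cvg _] := nonincreasing_subsequence_cvg V_ni m_oo Vm.
have gap : V p k - 4 * alpha * f p @[k --> \oo] --> (0 : R).
  by rewrite -(subrr (4 * alpha * f p)); apply: cvgB V_cvg (cvg_cst _).
apply: cvg_sqr_enorm0; apply: (squeeze_cvgr _ (cvg_cst 0) gap).
apply: nearW => k; rewrite sqr_ge0/=.
have := ler_wpM2l (ltW alpha_gt0) (F_ge k).
have := mulr_ge0 (sqr_ge0 alpha) (B_ge0 k).
rewrite /V; lra.
Qed.

(** If the nonincreasing [F] stayed above [A], then, its error term tending to 0,
    the values [f (x k)] would eventually exceed [f y], which forces a cluster
    point and hence a minimizer. *)
Lemma eventually_below y A : minimizers C f = set0 -> C y -> f y < A ->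
  \forall k \near \oo, f (x k) < A.
Proof.
move=> no_min Cy fyA.
have [[N FN]|F_ge] := pselect (exists N, F N < A).
  exists N => // k /= Nk; apply: le_lt_trans (f_le_F k) _.
  exact: le_lt_trans (F_ni Nk) FN.
exfalso.
have cB : c * B k @[k --> \oo] --> (0 : R).
  by rewrite -(mulr0 c); exact: cvgMl_tmp.
have fyA0 : 0 < A - f y by rewrite subr_gt0.
move/cvgrPdist_lt : cB => /(_ _ fyA0)[N _ cBN].
have [|p /cluster_minimizer] := @lower_level_cluster y N Cy.
  move=> k Nk; have := cBN k Nk; rewrite /= sub0r normrN.
  move=> /(le_lt_trans (ler_norm _)).
  have : A <= F k by rewrite leNgt; apply/negP => Fk; apply: F_ge; exists k.
  rewrite /F; lra.
by rewrite no_min.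
Qed.

Lemma cvg_ereal_inf : minimizers C f = set0 ->
  (f (x k))%:E @[k --> \oo] --> ereal_inf [set (f y)%:E | y in C].
Proof.
move=> no_min; set S := [set (f y)%:E | y in C].
have f_ge k : (ereal_inf S <= (f (x k))%:E)%E.
  by apply: ereal_inf_lbound; exists (x k).
have f_lt A : (ereal_inf S < A%:E)%E -> \forall k \near \oo, f (x k) < A.
  move=> /ereal_inf_lt[_ [y Cy <-]]; rewrite lte_fin.
  exact: eventually_below.
case: (ereal_inf S) f_ge f_lt => [l| |] f_ge f_lt.
- apply: cvg_EFin; first exact: nearW.
  apply/cvgrPdist_lt => e e_gt0.
  have := f_lt (l + e); rewrite lte_fin ltrDl => /(_ e_gt0).
  apply: filterS => k /= fk; rewrite distrC ger0_norm ?ltrBlDl//.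
  by rewrite subr_ge0 -lee_fin.
- by have := f_ge 0%N; rewrite leye_eq.
- apply/cvgeNyPlt => A; have := f_lt A; rewrite ltNyr => /(_ isT).
  by apply: filterS => k; rewrite lte_fin.
Qed.

Lemma enorm_cvg_pinfty : cluster (x @ \oo) = set0 ->
  enorm (x k) @[k --> \oo] --> +oo.
Proof.
move=> no_cluster; apply/cvgryPge => A; apply/not_notP => not_near.
have [N|p] := @bounded_subsequence_cluster _ _ x A; last by rewrite no_cluster.
apply/not_exists2P => small; apply: not_near; exists N => // k /= Nk.
by have [//|/negP] := small k; rewrite -ltNge => /ltW.
Qed.

End asymptotics.

(** * Convergence of the projection method *)

Theorem theorem10 (R : realType) (n : nat) (C : set 'rV[R]_n)
    (f : 'rV[R]_n -> R) (L : R)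
    (phi : R -> R -> R -> 'rV[R]_n -> 'rV[R]_n -> 'rV[R]_n -> R)
    (bm1 : R) (b a : nat -> R) (gbar2 gbar alpha : R) (x : nat -> 'rV[R]_n)
    (C_nonempty : C !=set0) (C_closed : closed C) (C_convex : convex_set C)
    (f_C1 : continuously_differentiable f)
    (L_gt0 : 0 < L) (f_lip : grad_lipschitz_on C f L)
    (phi_tol : error_tolerance phi)
    (ab_forcing : forcing_sequences bm1 b a)
    (gbar2_lt : gbar2 < 1 / 2) (gbar_lt : gbar < 1 / 2)
    (alpha_gt0 : 0 < alpha) (alpha_lt : alpha < (1 - 2 * gbar) / L)
    (x_run : GInexPM_run C f phi a gbar2 gbar alpha x)
    (f_pseudo : pseudoconvex C f) :
  [/\ minimizers C f !=set0 <-> cluster (x @ \oo) !=set0,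
      minimizers C f !=set0 ->
        exists2 xstar, minimizers C f xstar & x @ \oo --> xstar &
      minimizers C f = set0 ->
        enorm (x k) @[k --> \oo] --> +oo /\
        (f (x k))%:E @[k --> \oo] --> ereal_inf [set (f y)%:E | y in C]].
Proof.
have [b_ni b_ge0 b_cvg0 [b0_lt bm1_gt0] a_bnd] := ab_forcing.
have [Cx0 x_step] := x_run.
have Cx k : C (x k).
  by case: k => // k; have [_ [g1 [g2 [g3 [_ _ _ _ []]]]]] := x_step k.
pose B k : R := if k is k'.+1 then b k' else bm1.
have B_ni : nonincreasing_seq B.
  by apply/nonincreasing_seqP => -[|k] /=; [exact: ltW|exact: b_ni].
have B_cvg0 : B @ \oo --> (0 : R) by rewrite -(cvg_shiftS B).
pose c := alpha / (1 - 2 * gbar2).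
have c_ge0 : 0 <= c by rewrite divr_ge0 ?(ltW alpha_gt0)//; lra.
pose F k := f (x k) + c * B k.
have f_diff := proj1 f_C1.
(* a k is at most B k - B k.+1, so the error terms telescope into F and B *)
have caF k : f (x k) - f (x k.+1) + c * a k <= F k - F k.+1.
  have := ler_wpM2l c_ge0 (a_bnd k).2.
  rewrite /F -/(B k) -/(B k.+1); lra.
have decrease k :
    enorm (x k.+1 - x k) ^+ 2 <= 2 * alpha * (F k - F k.+1).
  have [g_neq0 [g1 [g2 [g3 [[g1_ge0 g2_ge0 g3_ge0] g12 g2_lt g3_lt proj]]]]] :=
    x_step k.
  have phig_le u v w := (phi_tol _ _ _ g1_ge0 g2_ge0 g3_ge0 u v w).2.
  have := sufficient_decrease C_convex f_diff f_lip L_gt0 alpha_gt0 gbar2_lt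
    gbar_lt alpha_lt g1_ge0 g2_ge0 g3_ge0 g2_lt g3_lt g_neq0 g12 phig_le (Cx k)
    proj.
  have := ler_wpM2l (ltW alpha_gt0) (caF k); rewrite -/c; lra.
have quasi_fejer y k : C y ->
    enorm (x k.+1 - y) ^+ 2 - enorm (x k - y) ^+ 2 <=
    4 * alpha * (F k - F k.+1) + 2 * alpha ^+ 2 * (B k - B k.+1)
    + 2 * alpha * dotv (grad f (x k)) (y - x k).
  move=> Cy.
  have [g_neq0 [g1 [g2 [g3 [[g1_ge0 g2_ge0 g3_ge0] g12 g2_lt g3_lt proj]]]]] :=
    x_step k.
  have phig_le u v w := (phi_tol _ _ _ g1_ge0 g2_ge0 g3_ge0 u v w).2.
  have := quasi_fejer_step C_convex f_diff f_lip L_gt0 alpha_gt0 gbar2_lt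
    gbar_lt alpha_lt g1_ge0 g2_ge0 g3_ge0 g2_lt g3_lt g_neq0 g12 phig_le (Cx k)
    proj Cy.
  have := ler_wpM2l (ltW alpha_gt0) (caF k).
  have := ler_wpM2l (sqr_ge0 alpha) (a_bnd k).2.
  rewrite -/c -/(B k) -/(B k.+1); lra.
have cluster_min p : cluster (x @ \oo) p -> minimizers C f p.
  exact: (cluster_minimizer C_closed f_C1 f_pseudo alpha_gt0 B_cvg0 Cx
    decrease quasi_fejer).
have min_cluster : minimizers C f !=set0 -> cluster (x @ \oo) !=set0.
  move=> [y [Cy y_min]].
  apply: (lower_level_cluster C_convex f_C1 f_pseudo alpha_gt0 c_ge0 B_ni
    B_cvg0 Cx quasi_fejer (N := 0) Cy) => k _; exact: y_min.
split.
- by split=> // -[p /cluster_min]; exists p.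
- move=> /min_cluster[p xp]; exists p; first exact: cluster_min.
  exact: (cluster_minimizer_cvg C_closed C_convex f_C1 f_pseudo alpha_gt0
    B_ni B_cvg0 Cx decrease quasi_fejer).
- move=> no_min; split.
    apply: enorm_cvg_pinfty; apply/seteqP; split=> // p /cluster_min.
    by rewrite no_min.
  exact: (cvg_ereal_inf C_closed C_convex f_C1 f_pseudo alpha_gt0 c_ge0
    B_ni B_cvg0 Cx decrease quasi_fejer no_min).
Qed.
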